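(* For every $n\ge 1$ there exists a constant $B_n\in(0,\infty)$ depending only on $n$ such that for all $\lambda\in(0,1)$, $$C_n(\lambda)\ge 1+\frac{1-\lambda}{B_n\lambda}.$$
   Context: Let $Q\subset\mathbb R^n$ be a cube. $M_Q$ denotes the Hardy--Littlewood maximal operator restricted to $Q$: for $x\in Q$, $$M_Qf(x):=\sup_{R\ni x,\ R\subset Q}\frac1{|R|}\int_R|f|,$$ where the supremum is over all cubes $R\subset Q$ containing $x$. Here $|A|$ denotes Lebesgue measure and $\chi_E$ the indicator function of $E$. For $\lambda\in(0,1)$ define $$C_n(\lambda):=\inf_{E\subset Q:\ 0<|E|\le\lambda|Q|}\frac{|\{x\in Q: M_Q\chi_E(x)>\lambda\}|}{|E|},$$ where the infimum is over measurable sets $E\subset Q$ (by translation and dilation invariance this does not depend on the cube $Q$). *)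

(* Defs.v *)
From HB Require Import structures.
From mathcomp Require Import all_boot all_order all_algebra.
From mathcomp Require Import all_classical all_reals all_analysis.

Set Implicit Arguments.
Unset Strict Implicit.
Unset Printing Implicit Defensive.
Import Order.TTheory GRing.Theory Num.Theory.
Import numFieldNormedType.Exports.

Local Open Scope classical_set_scope.
Local Open Scope ring_scope.

Section borel_lebesgue_step.
Context {R : realType} {n : nat}.
Variable mu : {sigma_finite_measure set (n.-tuple (measurableTypeR R)) -> \bar R}.

Definition tcons (p : measurableTypeR R * n.-tuple (measurableTypeR R)) :
  n.+1.-tuple (measurableTypeR R) := [tuple of p.1 :: p.2].

Lemma measurable_tcons : measurable_fun [set: _] tcons.
Proof. by apply: measurable_cons. Qed.

Let prod : {measure set (measurableTypeR R * n.-tuple (measurableTypeR R))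
    -> \bar R} := (@lebesgue_measure R \x mu)%E.

Definition lebesgue_step : set (n.+1.-tuple (measurableTypeR R)) -> \bar R :=
  pushforward (@lebesgue_measure R \x mu)%E tcons.

Let lebesgue_step0 : (lebesgue_step set0 = 0)%E.
Proof. by rewrite /lebesgue_step /pushforward preimage_set0 measure0. Qed.

Let lebesgue_step_ge0 A : (0 <= lebesgue_step A)%E.
Proof. exact: (measure_ge0 prod). Qed.

Let lebesgue_step_sigma_additive : semi_sigma_additive lebesgue_step.
Proof.
move=> F mF tF mUF; rewrite /lebesgue_step /pushforward preimage_bigcup.
apply: (@measure_semi_sigma_additive _ _ _ prod).
- by move=> k; rewrite -[X in measurable X]setTI; exact: measurable_tcons.
- apply/trivIsetP => /= i j _ _ ij; rewrite -preimage_setI.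
  by move/trivIsetP : tF => /(_ _ _ _ _ ij) ->//; rewrite preimage_set0.
- rewrite -preimage_bigcup -[X in measurable X]setTI.
  exact: measurable_tcons.
Qed.

HB.instance Definition _ := isMeasure.Build _ _ _ lebesgue_step
  lebesgue_step0 lebesgue_step_ge0 lebesgue_step_sigma_additive.

(* The library instance for [_ \x _] that unification finds only covers
   subprobabilities, so sigma-finiteness is established here. *)
Let lebesgue_step_sigma_finite : sigma_finite setT lebesgue_step.
Proof.
pose tsplit (t : n.+1.-tuple (measurableTypeR R)) :
  measurableTypeR R * n.-tuple (measurableTypeR R) :=
  (thead t, [tuple of behead t]).
have tconsK : cancel tcons tsplit.
  by case=> x t; congr pair; apply/val_inj.
have mtsplit : measurable_fun [set: _] tsplit.
  by apply/measurable_fun_pairP; split; [exact: measurable_tnth|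
    exact: measurable_behead].
have /sigma_finiteP[F [FT ndF Foo]] := sigma_finiteT (@lebesgue_measure R).
have /sigma_finiteP[G [GT ndG Goo]] := sigma_finiteT mu.
exists (fun k => tsplit @^-1` (F k `*` G k)).
  rewrite -preimage_bigcup (_ : \bigcup_k (F k `*` G k) = setT)//.
  rewrite -setXTT FT GT predeqE => -[x y]; split.
    by move=> [k _ []/= ? ?]; split; exists k.
  move=> [/= [i _ Fix] [j _ Gjy]]; exists (maxn i j) => //; split.
  - by move: x Fix; exact/subsetPset/ndF/leq_maxl.
  - by move: y Gjy; exact/subsetPset/ndG/leq_maxr.
move=> k; have [[mF muF] [mG muG]] := (Foo k, Goo k); split.
  by rewrite -[X in measurable X]setTI; apply: mtsplit => //; exact: measurableX.
rewrite /lebesgue_step /pushforward -comp_preimage.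
rewrite (_ : tsplit \o tcons = id); last first.
  by rewrite funeqE => x /=; exact: tconsK.
by rewrite preimage_id product_measure1E// lte_mul_pinfty// ge0_fin_numE.
Qed.

HB.instance Definition _ := Measure_isSigmaFinite.Build _ _ _ lebesgue_step
  lebesgue_step_sigma_finite.

End borel_lebesgue_step.

Fixpoint borel_lebesgue (R : realType) (n : nat) :
  {sigma_finite_measure set (n.-tuple (measurableTypeR R)) -> \bar R} :=
  match n with
  | 0%N => \d_([tuple] : 0.-tuple (measurableTypeR R))
  | m.+1 => lebesgue_step (borel_lebesgue R m)
  end.

Lemma borel_lebesgue_box (R : realType) (n : nat) (A : 'I_n -> set (measurableTypeR R)) :
  (forall i, measurable (A i)) ->
  borel_lebesgue R n [set x | forall i, A i (tnth x i)] =
  (\prod_(i < n) lebesgue_measure (A i))%E.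
Proof.
elim: n A => [|n IH] A mA.
  by rewrite big_ord0 /= diracE mem_set// => -[].
rewrite big_ord_recl -IH// /= /lebesgue_step /pushforward.
rewrite (_ : tcons @^-1` _ =
    A ord0 `*` [set x | forall i : 'I_n, A (lift ord0 i) (tnth x i)]).
  rewrite product_measure1E//.
  rewrite (_ : [set x | _] = \bigcap_(i : 'I_n)
      (fun x => tnth x i) @^-1` A (lift ord0 i)); last first.
    by apply/seteqP; split=> x /= h i; [move=> _; exact: h|exact: h].
  apply: fin_bigcap_measurable => //.
  move=> i _; rewrite -[X in measurable X]setTI.
  by apply: measurable_tnth.
apply/seteqP; split=> -[x y] /=.
  move=> h; split; first exact: (h ord0).
  by move=> i; have := h (lift ord0 i); rewrite /tcons tnthS.
move=> [h0 h] i; case: (unliftP ord0 i) => [j ->|->] //.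
by rewrite /tcons tnthS; exact: h.
Qed.

(* The sigma-algebra on [Rn R n] is that of the Lebesgue measurable sets: the
   Caratheodory measurable sets for the outer measure induced by the n-fold
   product of the one-dimensional Lebesgue measure. *)
Definition Rn (R : realType) (n : nat) :=
  caratheodory_type (borel_lebesgue R n)^*%mu.

HB.instance Definition _ R n := Measurable.on (Rn R n).

Definition lebesgue (R : realType) (n : nat) : {measure set (Rn R n) -> \bar R} :=
  @completed_measure_extension _ _ R (borel_lebesgue R n).

Section maximal_operator.
Context {R : realType} {n : nat}.
Local Notation mu := (lebesgue R n).
Local Open Scope ereal_scope.

(* Cubes are closed, nondegenerate, and have sides parallel to the axes. *)
Definition cube (a : Rn R n) (r : R) : set (Rn R n) :=
  [set x : Rn R n | forall i, (tnth a i <= tnth x i <= tnth a i + r)%R].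

Definition is_cube (Q : set (Rn R n)) : Prop :=
  exists a r, (0 < r)%R /\ Q = cube a r.

Definition cube_maximal (Q : set (Rn R n)) (f : Rn R n -> R) (x : Rn R n)
    : \bar R :=
  ereal_sup [set (\int[mu]_(y in S) `|(f y)%:E|) / mu S |
             S in [set S | [/\ is_cube S, S x & S `<=` Q]]].

Definition tauberian_const (Q : set (Rn R n)) (lambda : R) : \bar R :=
  ereal_inf [set mu [set x | Q x /\ lambda%:E < cube_maximal Q \1_E x] / mu E |
             E in [set E | [/\ measurable E, E `<=` Q, 0 < mu E &
                              mu E <= lambda%:E * mu Q]]].

End maximal_operator.

(* Main.v *)
Require Import Defs.
From mathcomp Require Import all_boot all_order all_algebra.
From mathcomp Require Import all_classical all_reals all_analysis.
From mathcomp Require Import measurable_realfun ring lra.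
Import Order.TTheory GRing.Theory Num.Theory.
Import numFieldNormedType.Exports.
Local Open Scope classical_set_scope.
Local Open Scope ring_scope.
Set Implicit Arguments.
Unset Strict Implicit.
Unset Printing Implicit Defensive.

(** Enlarging the cubes of a dyadic stopping time gives the bound, with
    [B = 2 ^ (n + 1)].

    Replace [Q] by the half-open cube with the same corner, which differs from
    it by a null set, and subdivide it dyadically. Fix a threshold [t] with
    [lambda < t < 1]. Call a dyadic cube heavy when [E] fills at least the
    fraction [t] of it. The whole cube is not heavy, since
    [|E| <= lambda |Q| < t |Q|], whereas almost every point of [E] lies in a
    heavy cube ([ae_heavy], a dyadic form of the Lebesgue density theorem).
    Hence almost every point of [E] lies in a light cube that has a heavy
    child. The maximal cubes [C] of this kind are disjoint and cover almost
    all of [E] ([selected_inj], [selected_cover]).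

    Inside such a [C], grow the heavy child continuously to [C]. The density of
    [E] starts at or above [t] and ends below it, so some intermediate cube [S]
    has density exactly [t] ([hbox_grow]). On this cube [S]:
    - the average of the indicator of [E] is [t > lambda], so that [S] lies in
      the superlevel set of the maximal function ([hbox_sub_maximal]);
    - the gain [|S \ E|] equals [(1 - t) |S|], and
      [|S| >= 2^-n |C| >= |E & C| / (2^n t)], since [S] contains a child of
      [C] and [C] is light.

    Summing over the disjoint cubes [C], the superlevel set contains almost all
    of [E] and, outside [E], a set of measure at least
    [(1 - t) / (2^n t) |E|] ([lebesgue_gain]). The choice
    [t = 2 lambda / (1 + lambda)] turns the factor into
    [(1 - lambda) / (2^(n+1) lambda)], so that no limit [t -> lambda] has to
    be taken. *)

(** * Boxes and their Lebesgue measure *)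

Section measure.
Context {R : realType} {n : nat}.
Local Notation mu := (lebesgue R n).

Lemma borel_measurable (A : set (n.-tuple (measurableTypeR R))) :
  measurable A -> measurable (A : set (Rn R n)).
Proof. exact: caratheodory_measurable_mu_ext. Qed.

Lemma lebesgueE (A : set (n.-tuple (measurableTypeR R))) :
  measurable A -> mu A = borel_lebesgue R n A.
Proof. exact: measurable_mu_extE. Qed.

Lemma le_lebesgue (A B : set (Rn R n)) : A `<=` B -> (mu A <= mu B)%E.
Proof. by move=> AB; exact: (le_mu_ext (borel_lebesgue R n) AB). Qed.

Lemma lebesgueU_le (A B : set (Rn R n)) : (mu (A `|` B) <= mu A + mu B)%E.
Proof.
exact: (@outer_measureU2 _ _ (borel_lebesgue R n)^*%mu A B).
Qed.

Lemma measurable_box (I : 'I_n -> set (measurableTypeR R)) :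
  (forall i, measurable (I i)) ->
  measurable [set x : n.-tuple (measurableTypeR R) | forall i, I i (tnth x i)].
Proof.
move=> mI; rewrite (_ : [set x | _] = \bigcap_(i : 'I_n)
    (fun x => tnth x i) @^-1` I i); last first.
  by apply/seteqP; split=> x /= h i; [move=> _; exact: h|exact: h].
apply: fin_bigcap_measurable => // i _; rewrite -[X in measurable X]setTI.
by apply: measurable_tnth => //; exact: mI.
Qed.

(** Half-open cubes, unlike closed ones, are partitioned by their dyadic
    subcubes. *)
Definition hbox (b : n.-tuple R) (s : R) : set (Rn R n) :=
  [set x : Rn R n | forall i, tnth b i <= tnth x i < tnth b i + s].

Lemma hboxE b s : hbox b s =
  [set x | forall i, `[tnth b i, (tnth b i + s)%R[%classic (tnth x i)].
Proof. by apply/seteqP; split=> x h i; have := h i; rewrite /= in_itv. Qed.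

Lemma cubeE (b : Rn R n) s : cube b s =
  [set x | forall i, `[tnth b i, (tnth b i + s)%R]%classic (tnth x i)].
Proof. by apply/seteqP; split=> x h i; have := h i; rewrite /= in_itv. Qed.

Lemma measurable_hbox b s : measurable (hbox b s).
Proof.
apply: borel_measurable; rewrite hboxE.
by apply: (@measurable_box (fun i => `[tnth b i, (tnth b i + s)%R[%classic)).
Qed.

Lemma measurable_cube (b : Rn R n) s : measurable (cube b s).
Proof.
apply: borel_measurable; rewrite cubeE.
by apply: (@measurable_box (fun i => `[tnth b i, (tnth b i + s)%R]%classic)).
Qed.

Lemma lebesgue_box (I : 'I_n -> set (measurableTypeR R)) (s : R) :
  (forall i, measurable (I i)) -> (forall i, lebesgue_measure (I i) = s%:E) ->
  mu [set x : Rn R n | forall i, I i (tnth x i)] = (s ^+ n)%:E.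
Proof.
move=> mI Is; rewrite lebesgueE; last exact: measurable_box.
rewrite borel_lebesgue_box// (eq_bigr (fun=> s%:E))//.
by rewrite prodEFin prodr_const card_ord.
Qed.

Lemma lebesgue_hbox b s : 0 <= s -> mu (hbox b s) = (s ^+ n)%:E.
Proof.
move=> s0; rewrite hboxE.
apply: (@lebesgue_box (fun i => `[tnth b i, (tnth b i + s)%R[%classic)) => // i.
rewrite lebesgue_measure_itv /= lte_fin ltrDl.
by case: ltgtP s0 => // [s0 _|<- _//]; rewrite -EFinB addrAC subrr add0r.
Qed.

Lemma lebesgue_cube (b : Rn R n) s : 0 <= s -> mu (cube b s) = (s ^+ n)%:E.
Proof.
move=> s0; rewrite cubeE.
apply: (@lebesgue_box (fun i => `[tnth b i, (tnth b i + s)%R]%classic)) => // i.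
rewrite lebesgue_measure_itv /= lte_fin ltrDl.
by case: ltgtP s0 => // [s0 _|<- _//]; rewrite -EFinB addrAC subrr add0r.
Qed.

Lemma hbox_sub_cube b s : hbox b s `<=` cube (b : Rn R n) s.
Proof. by move=> x xb i; have /andP[-> /ltW] := xb i. Qed.

Lemma lebesgue_cube_boundary b s : 0 <= s ->
  mu (cube (b : Rn R n) s `\` hbox b s) = 0%E.
Proof.
move=> s0; set Q := cube _ _; set Q0 := hbox b s.
have : mu Q = (mu (Q `\` Q0) + mu (Q `&` Q0))%E.
  by apply: measureDI; [exact: measurable_cube|exact: measurable_hbox].
rewrite setIidr; last exact: hbox_sub_cube.
rewrite lebesgue_cube// lebesgue_hbox//.
by case: (mu (_ `\` _)) => [y|//|//] [yE]; congr EFin; lra.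
Qed.

End measure.

(** * The dyadic grid of a half-open cube *)

Section grid.
Context {R : realType} {n : nat}.
Variables (a : n.-tuple R) (r : R).
Hypothesis r0 : 0 < r.

Definition dcube (k : nat) (j : n.-tuple nat) : set (Rn R n) :=
  hbox [tuple tnth a i + r / 2 ^+ k * (tnth j i)%:R | i < n] (r / 2 ^+ k).

(** In the coordinates where the base cube is the unit cube scaled by [2 ^ k],
    the index of a dyadic cube is the integer part of its points. *)
Lemma dcubeP k j (x : Rn R n) : dcube k j x <->
  forall i, (tnth j i)%:R <= (tnth x i - tnth a i) / r * 2 ^+ k
                           < (tnth j i).+1%:R.
Proof.
have h0 : 0 < r / 2 ^+ k by rewrite divr_gt0// exprn_gt0.
have E y c (m : nat) : (m%:R <= (y - c) / r * 2 ^+ k < m.+1%:R) =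
    (c + r / 2 ^+ k * m%:R <= y < c + r / 2 ^+ k * m%:R + r / 2 ^+ k).
  rewrite -mulrA [r^-1 * _]mulrC -(invf_div r) ler_pdivlMr// ltr_pdivrMr//.
  by rewrite -natr1; congr (_ && _); apply/idP/idP => ?; lra.
by split=> h i; have := h i; rewrite tnth_mktuple E.
Qed.

Lemma dcube_nested k k' j j' x : (k <= k')%N ->
  dcube k j x -> dcube k' j' x -> dcube k' j' `<=` dcube k j.
Proof.
move=> kk' /dcubeP xj /dcubeP xj' y /dcubeP yj'; apply/dcubeP => i.
have := xj i; have := xj' i; have := yj' i.
rewrite -(subnK kk') addnC exprD !mulrA.
set u := _ / r * _; set v := _ / r * _; set p := 2 ^+ _.
move: (tnth j i) (tnth j' i) => m m' /andP[vl vu] /andP[ul uu] /andP[Ul Uu].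
have p0 : 0 < p by rewrite exprn_gt0.
have pE : p = (2 ^ (k' - k))%:R by rewrite natrX.
have lo : m%:R * p <= m'%:R.
  rewrite pE -natrM ler_nat -ltnS -(ltr_nat R) natrM -pE.
  by apply: le_lt_trans uu; rewrite ler_pM2r.
have hi : m'.+1%:R <= m.+1%:R * p.
  rewrite pE -natrM ler_nat -(ltr_nat R) natrM -pE.
  by apply: le_lt_trans ul _; rewrite ltr_pM2r.
apply/andP; split.
  by rewrite -(ler_pM2r p0); exact: le_trans lo vl.
by rewrite -(ltr_pM2r p0); exact: lt_le_trans vu hi.
Qed.

Lemma dcube_inj k j j' x : dcube k j x -> dcube k j' x -> j = j'.
Proof.
move=> /dcubeP xj /dcubeP xj'; apply: eq_from_tnth => i.
by rewrite -(truncn_def (xj i)) -(truncn_def (xj' i)).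
Qed.

Definition zero_index : n.-tuple nat := [tuple 0%N | i < n].

Lemma dcube0 : dcube 0 zero_index = hbox a r.
Proof.
rewrite /dcube expr0 divr1; congr hbox; apply: eq_from_tnth => i.
by rewrite !tnth_mktuple mulr0 addr0.
Qed.

Lemma dcube_cover k x : hbox a r x -> exists j, dcube k j x.
Proof.
rewrite -dcube0 => /dcubeP xr.
exists [tuple Num.truncn ((tnth x i - tnth a i) / r * 2 ^+ k) | i < n].
apply/dcubeP => i; rewrite tnth_mktuple truncn_itv// mulr_ge0//.
by have /andP[] := xr i; rewrite tnth_mktuple expr0 mulr1.
Qed.

Lemma dcube_sub k j x : hbox a r x -> dcube k j x -> dcube k j `<=` hbox a r.
Proof. by rewrite -dcube0; exact: dcube_nested. Qed.

Lemma measurable_dcube k j : measurable (dcube k j).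
Proof. exact: measurable_hbox. Qed.

Lemma lebesgue_dcube k j : lebesgue R n (dcube k j) = ((r / 2 ^+ k) ^+ n)%:E.
Proof. by rewrite lebesgue_hbox// divr_ge0 ?exprn_ge0// ltW. Qed.

End grid.

(** * Summation over disjoint families *)

(** The disjoint sets [D i] carry the disjointness of both families at once, so
    that countable additivity applies on either side. *)
Lemma countable_sum_le d (T : measurableType d) (R : realType)
    (mu : {measure set T -> \bar R}) (I : countType) (D F H : I -> set T)
    (c : R) : 0 <= c ->
  (forall i j x, D i x -> D j x -> i = j) ->
  (forall i, measurable (F i)) -> (forall i, measurable (H i)) ->
  (forall i, F i `<=` D i) -> (forall i, H i `<=` D i) ->
  (forall i, c%:E * mu (F i) <= mu (H i))%E ->
  (c%:E * mu (\bigcup_i F i) <= mu (\bigcup_i H i))%E.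
Proof.
move=> c0 dD mF mH FD HD cFH.
pose ex (G : I -> set T) m := oapp G set0 (pickle_inv m).
have exU G : \bigcup_i G i = \bigcup_m ex G m.
  apply/seteqP; split=> [x [i _ Gx]|x [m _]].
    by exists (pickle i) => //; rewrite /ex pickleK_inv.
  by rewrite /ex; case: pickle_inv => [i Gx|//]; exists i.
have exm G : (forall i, measurable (G i)) -> forall m, measurable (ex G m).
  by move=> mG m; rewrite /ex; case: pickle_inv => /=.
have ext G : (forall i, G i `<=` D i) -> trivIset setT (ex G).
  move=> GD; apply/trivIsetP => m m' _ _.
  apply: contra_neqP => /eqP/set0P[x []].
  rewrite /ex; case E: pickle_inv => [i|//]; case E': pickle_inv => [i'|//].
  move=> /= /GD Gx /GD Gx'; have ii' := dD _ _ _ Gx Gx'.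
  by rewrite -(@pickle_invK I m) -(@pickle_invK I m') E E' /= ii'.
have exS G : (forall i, measurable (G i)) -> (forall i, G i `<=` D i) ->
    mu (\bigcup_i G i) = (\sum_(m <oo) mu (ex G m))%E.
  move=> mG GD; rewrite exU measure_semi_bigcup//; [exact: exm|exact: ext|].
  by apply: bigcup_measurable => m _; exact: exm.
rewrite !exS//.
rewrite -nneseriesZl//; apply: lee_nneseries => // m _.
  by rewrite mule_ge0.
by rewrite /ex; case: pickle_inv => [i|] /=; rewrite ?measure0 ?mule0.
Qed.

(** * Approximation of Borel sets by finite unions of grid cubes *)

Section approximation.
Context {R : realType} {n : nat}.
Variables (a : n.-tuple R) (r : R).
Hypothesis r0 : 0 < r.
Local Notation mu := (lebesgue R n).

(** Within the base cube, the unions of grid cubes of generation [k]. Stating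
    this by saturation makes stability under complements and unions
    immediate. *)
Definition grid_saturated k (D : set (Rn R n)) :=
  forall j x y, hbox a r x -> dcube a r k j x -> dcube a r k j y -> D x -> D y.

Definition grid_approx (A : set (Rn R n)) := forall e : R, 0 < e ->
  exists k D, grid_saturated k D /\ (mu ((A `+` D) `&` hbox a r) <= e%:E)%E.

Lemma grid_saturatedW k k' D : (k <= k')%N ->
  grid_saturated k D -> grid_saturated k' D.
Proof.
move=> kk' gD j x y xQ xj yj; have [j0 xj0] := dcube_cover r0 k xQ.
by apply: (gD _ _ _ xQ xj0); exact: (dcube_nested r0 kk' xj0 xj yj).
Qed.

Lemma grid_approxC A : grid_approx A -> grid_approx (~` A).
Proof.
move=> aA e /aA[k [D [gD AD]]]; exists k, (~` D); split.
  move=> j x y xQ xj yj Dx Dy; apply: Dx.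
  exact: (gD _ _ _ (dcube_sub r0 xQ xj yj) yj xj Dy).
rewrite (_ : _ `+` _ = A `+` D)//.
by rewrite /setY !setDE !setCK setUC (setIC (~` A)) (setIC (~` D)).
Qed.

Lemma grid_saturated_approx k D : grid_saturated k D -> grid_approx D.
Proof.
move=> gD e e0; exists k, D; split => //.
by rewrite setYK set0I measure0 lee_fin ltW.
Qed.

Lemma grid_approxU A B :
  grid_approx A -> grid_approx B -> grid_approx (A `|` B).
Proof.
move=> aA aB e e0; have e20 : 0 < e / 2 by rewrite divr_gt0.
have [k [D [gD AD]]] := aA _ e20; have [k' [D' [gD' BD']]] := aB _ e20.
exists (maxn k k'), (D `|` D'); split.
  move=> j x y xQ xj yj [Dx|D'x]; [left|right].
    exact: (grid_saturatedW (leq_maxl k k') gD xQ xj yj Dx).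
  exact: (grid_saturatedW (leq_maxr k k') gD' xQ xj yj D'x).
rewrite [e]splitr EFinD; apply: le_trans (leeD AD BD').
apply: le_trans (lebesgueU_le _ _); apply: le_lebesgue.
move=> x [[[[Ax|Bx] nD]|[[Dx|Dx] nA]] Qx].
- by left; split => //; left; split => // Dx; apply: nD; left.
- by right; split => //; left; split => // Dx; apply: nD; right.
- by left; split => //; right; split => // Ax; apply: nA; left.
- by right; split => //; right; split => // Bx; apply: nA; right.
Qed.

(** Continuity from above reduces the countable union to a finite one: inside
    the base cube, which has finite measure, the part of the union missed by the
    first [N] sets has measure tending to [0]. *)
Lemma grid_approx_bigcup (A : (set (Rn R n))^nat) :
  (forall m, measurable (A m)) -> (forall m, grid_approx (A m)) ->
  grid_approx (\bigcup_m A m).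
Proof.
move=> mA aA e e0; have e20 : 0 < e / 2 by rewrite divr_gt0.
pose U N := \big[setU/set0]_(m < N) A m.
have aU N : grid_approx (U N).
  rewrite /U; elim: N => [|N IH].
    by rewrite big_ord0; exact: (@grid_saturated_approx 0).
  by rewrite big_ord_recr; exact: grid_approxU.
have mU N : measurable (U N) by exact: bigsetU_measurable.
pose V N := (\bigcup_m A m `\` U N) `&` hbox a r.
have mV N : measurable (V N).
  apply: measurableI (measurable_hbox _ _); apply: measurableD => //.
  exact: bigcup_measurable.
have V0 : \bigcap_N V N = set0.
  rewrite -subset0 => x Vx; have [[m _ Amx] _] := (Vx 0%N I).1.
  have [[_ nU] _] := Vx m.+1 I; apply: nU.
  by rewrite /U big_ord_recr; right.
have Vcvg : mu (V N) @[N --> \oo] --> mu (\bigcap_N V N).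
  apply: nonincreasing_cvg_mu => //.
  - rewrite (le_lt_trans (le_lebesgue (@subIsetr _ _ _)))//.
    by rewrite lebesgue_hbox ?ltry// ltW.
  - by rewrite V0.
  - move=> N N' NN'; apply/subsetPset; apply: setSI; apply: setDS.
    exact: (@subset_bigsetU _ A).
have e2e : (0 < (e / 2)%:E)%E by rewrite lte_fin.
move: Vcvg; rewrite V0 measure0 => /(_ _ (open_ereal_lt' e2e))[N _ VN].
have {}VN : (mu (V N) < (e / 2)%:E)%E by apply: VN => /=.
have [k [D [gD UD]]] := aU N _ e20.
exists k, D; split => //.
rewrite [e]splitr EFinD; apply: le_trans (leeD (ltW VN) UD).
apply: le_trans (lebesgueU_le _ _); apply: le_lebesgue.
move=> x [[[Ax nD]|[Dx nA]] Qx].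
  have [Ux|nUx] := pselect (U N x); last by left.
  by right; split => //; left.
right; split => //; right; split => // Ux; apply: nA.
by move: Ux; rewrite /U -bigcup_mkord => -[m _ ?]; exists m.
Qed.

(** A half-space [c < x_i] is the increasing union of the half-spaces bounded by
    the first grid hyperplane of generation [k] strictly beyond [c], and those
    are unions of grid cubes of generation [k]. *)
Lemma grid_approx_ray (i : 'I_n) (c : R) : grid_approx [set x | c < tnth x i].
Proof.
have pow0 k : 0 < 2 ^+ k :> R by rewrite exprn_gt0.
(* If [c] lies below the base cube, the half-space contains all of it. *)
have [ca|ac] := ltP c (tnth a i).
  apply: (@grid_saturated_approx 0) => j x y xQ xj yj _ /=.
  by have /(_ i)/andP[+ _] := dcube_sub r0 xQ xj yj; exact: lt_le_trans.
pose m k := (Num.truncn ((c - tnth a i) / r * 2 ^+ k)).+1.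
pose A k : set (Rn R n) :=
  [set x | (m k)%:R <= (tnth x i - tnth a i) / r * 2 ^+ k].
have mA k (x : Rn R n) : A k x <-> tnth a i + r / 2 ^+ k * (m k)%:R <= tnth x i.
  have h0 : 0 < r / 2 ^+ k by rewrite divr_gt0.
  rewrite /A /= -mulrA [r^-1 * _]mulrC -(invf_div r) ler_pdivlMr//.
  by split => ?; lra.
have -> : [set x | c < tnth x i] = \bigcup_k A k.
  apply/seteqP; split => x /=.
    move=> cx; pose k := Num.truncn (r / (tnth x i - c)); exists k.+1 => //.
    apply/mA.
    have xc0 : 0 < tnth x i - c by rewrite subr_gt0.
    have : r / (tnth x i - c) < 2 ^+ k.+1.
      apply: lt_trans (_ : k.+1%:R < _); last first.
        by rewrite -natrX ltr_nat ltn_expl.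
      by have /andP[] := truncn_itv (ltW (divr_gt0 r0 xc0)).
    rewrite ltr_pdivrMr// mulrC -ltr_pdivrMr// => rk.
    have ca0 : 0 <= (c - tnth a i) / r * 2 ^+ k.+1.
      by rewrite mulr_ge0 ?divr_ge0 ?subr_ge0// ltW.
    have := truncn_itv ca0; rewrite /m; move: (Num.truncn _) => t /andP[+ _].
    rewrite -mulrA [r^-1 * _]mulrC -(invf_div r) ler_pdivlMr ?divr_gt0//.
    by rewrite -(@natr1 R t); move: rk; set h := r / _ => ? ?; lra.
  move=> [k _]; rewrite /A /= => /(lt_le_trans _) H.
  have : (c - tnth a i) / r * 2 ^+ k < (m k)%:R.
    have ca0 : 0 <= (c - tnth a i) / r * 2 ^+ k.
      by rewrite mulr_ge0 ?divr_ge0 ?subr_ge0// ltW.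
    by have /andP[] := truncn_itv ca0.
  by move/H; rewrite ltr_pM2r// ltr_pM2r ?invr_gt0// ltrD2r.
apply: grid_approx_bigcup => k.
  apply: borel_measurable.
  rewrite (_ : A k = (fun x => tnth x i) @^-1`
    `[tnth a i + r / 2 ^+ k * (m k)%:R, +oo[%classic); last first.
    by apply/seteqP; split => x; rewrite /= in_itv/= andbT => /mA.
  by rewrite -[X in measurable X]setTI; apply: measurable_tnth.
apply: (@grid_saturated_approx k) => j x y xQ /(dcubeP _ r0)/(_ i)/andP[_ xj].
move=> /(dcubeP _ r0)/(_ i)/andP[jy _]; rewrite /A /= => mx.
apply: le_trans jy; rewrite ler_nat -ltnS -(ltr_nat R).
exact: le_lt_trans mx xj.
Qed.

(** The approximable sets form a sigma-algebra, and the half-spaces [c < x_i]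
    generate the Borel sets. *)
Lemma borel_grid_approx (A : set (n.-tuple (measurableTypeR R))) :
  measurable A -> grid_approx A.
Proof.
pose C := [set A : set (n.-tuple (measurableTypeR R)) |
  measurable A /\ grid_approx A].
suff : measurable `<=` C by move=> h /h[].
have sC : sigma_algebra setT C.
  split.
  - by split => //; exact: (@grid_saturated_approx 0).
  - move=> B [mB aB]; rewrite setTD.
    by split; [exact: measurableC|exact: grid_approxC].
  - move=> F CF; split.
      by apply: bigcup_measurable => m _; exact: (CF m).1.
    apply: grid_approx_bigcup => m; last exact: (CF m).2.
    by apply: borel_measurable; exact: (CF m).1.
apply: smallest_sub => //; rewrite -bigcup_seq => B /= [i _ [Y mY <-]].
rewrite setTI; move: Y mY.
pose CY := [set Y : set (measurableTypeR R) | C ((fun x => tnth x i) @^-1` Y)].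
suff : measurable `<=` CY by move=> h Y /h.
rewrite RGenOInfty.measurableE; apply: smallest_sub.
  case: sC => C0 CC CU; split; rewrite /CY /=.
  - by rewrite preimage_set0.
  - by move=> Y /CC; rewrite !setTD preimage_setC.
  - by move=> F /CU; rewrite preimage_bigcup.
move=> _ [c ->]; split.
  rewrite -[X in measurable X]setTI.
  by apply: measurable_tnth.
rewrite (_ : _ @^-1` _ = [set x | c < tnth x i]); first exact: grid_approx_ray.
by apply/seteqP; split => x /=; rewrite in_itv /= andbT.
Qed.

End approximation.

(** * A dyadic density theorem *)

Section density.
Context {R : realType} {n : nat}.
Local Notation mu := (lebesgue R n).

(** The Lebesgue measure is by construction the outer measure obtained from
    Borel covers. *)
Lemma outer_approx (A : set (Rn R n)) (x : \bar R) : (mu A < x)%E ->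
  exists B : set (n.-tuple (measurableTypeR R)),
    [/\ measurable B, A `<=` B & (mu B < x)%E].
Proof.
move=> /ereal_inf_lt[_ [F [mF AF] <-] Fx]; exists (\bigcup_k F k); split => //.
  exact: bigcup_measurable.
apply: le_lt_trans Fx; rewrite lebesgueE; last exact: bigcup_measurable.
by apply: measure_sigma_subadditive => //; exact: bigcup_measurable.
Qed.

Variables (a : n.-tuple R) (r : R).
Hypothesis r0 : 0 < r.

(** Approximate [A] by a union [D] of grid cubes of one generation, up to an
    error [e]. Summing the hypothesis over these cubes gives
    [|A & D| <= t |D|], whence [|A| <= t |A| + O(e)], which forces [|A| = 0] as
    [t < 1]. *)
Lemma subdensity_null (A : set (Rn R n)) (t : R) : 0 < t < 1 ->
  measurable A -> A `<=` hbox a r ->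
  (forall k j, mu (A `&` dcube a r k j) <= t%:E * mu (dcube a r k j))%E ->
  mu A = 0%E.
Proof.
move=> /andP[t0 t1] mA AQ At.
have /fineK : mu A \is a fin_num.
  rewrite ge0_fin_numE//; apply: le_lt_trans (le_lebesgue AQ) _.
  by rewrite lebesgue_hbox ?ltry// ltW.
set m := fine _ => mE.
have [m0|m0] := leP m 0.
  by apply/eqP; rewrite eq_le measure_ge0 andbT -mE lee_fin.
(* The errors add up to at most [3 e], which has to stay below
   [m * (1 - t)]. *)
pose e := m * (1 - t) / 4.
have e0 : 0 < e by rewrite divr_gt0// mulr_gt0// subr_gt0.
have [|B [mB AB mue]] := @outer_approx A (m + e)%:E.
  by rewrite -mE lte_fin ltrDl.
have [k [D [gD BD]]] := borel_grid_approx a r0 mB e0.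
pose sel j := `[< exists x, [/\ hbox a r x, dcube a r k j x & D x] >].
pose H j := if sel j then dcube a r k j else set0.
have HD j x : H j x -> dcube a r k j x by rewrite /H; case: ifP.
have UH : \bigcup_j H j = D `&` hbox a r.
  apply/seteqP; split => x.
    move=> [j _]; rewrite /H; case: ifPn => // /asboolP[y [yQ yj Dy] xj].
    by split; [exact: (gD _ _ _ yQ yj)|exact: (dcube_sub r0 yQ yj)].
  move=> [Dx xQ]; have [j xj] := dcube_cover r0 k xQ; exists j => //.
  by rewrite /H ifT//; apply/asboolP; exists x.
have mH j : measurable (H j).
  by rewrite /H; case: ifP => // _; exact: measurable_dcube.
have : (t^-1%:E * mu (\bigcup_j (A `&` H j)) <= mu (\bigcup_j H j))%E.
  apply: (countable_sum_le (D := dcube a r k)) => //.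
  - by rewrite invr_ge0 ltW.
  - by move=> i j x; exact: dcube_inj.
  - by move=> j; exact: measurableI.
  - by move=> j x [_ /HD].
  - move=> j; rewrite /H; case: ifP => _; last by rewrite setI0 measure0 mule0.
    by rewrite lee_pdivrMl.
rewrite -setI_bigcupr UH lee_pdivrMl// => ADle.
have Dle : (mu (D `&` hbox a r) <= (m + e + e)%:E)%E.
  rewrite EFinD; apply: le_trans (leeD (ltW mue) BD).
  apply: le_trans (lebesgueU_le _ _); apply: le_lebesgue => x [Dx xQ].
  have [Bx|nB] := pselect (B x); first by left.
  by right; split => //; right.
have : (mu A <= (t * (m + e + e) + e)%:E)%E.
  rewrite EFinD EFinM.
  apply: (@le_trans _ _ (mu (A `&` (D `&` hbox a r)) +
                         mu ((B `+` D) `&` hbox a r))).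
    apply: le_trans (lebesgueU_le _ _); apply: le_lebesgue => x Ax.
    have [Dx|nD] := pselect (D x).
      by left; split => //; split => //; exact: AQ.
    by right; split; [left; split => //; exact: AB|exact: AQ].
  apply: leeD BD; apply: le_trans ADle _.
  by rewrite lee_pmul2l// lte_fin.
rewrite -mE lee_fin => H0; exfalso.
suff : m * (1 - t) < m * (1 - t) by rewrite ltxx.
have p0 : 0 < m * (1 - t) by rewrite mulr_gt0// subr_gt0.
have tp : t * (m * (1 - t)) < m * (1 - t) by rewrite gtr_pMl.
by move: H0; rewrite /e; lra.
Qed.

End density.

(** * Growing a cube to a prescribed density *)

Section grow.
Context {R : realType} {n : nat}.
Local Notation mu := (lebesgue R n).

Lemma lebesgue_hboxI_fin (E : set (Rn R n)) b s : 0 <= s ->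
  mu (E `&` hbox b s) \is a fin_num.
Proof.
move=> s0; rewrite ge0_fin_numE//.
by rewrite (le_lt_trans (le_lebesgue (@subIsetr _ _ _)))// lebesgue_hbox ?ltry.
Qed.

Lemma hbox_subP (d p : n.-tuple R) (h H : R) : 0 < h ->
  hbox d h `<=` hbox p H <->
  forall i, tnth p i <= tnth d i /\ tnth d i + h <= tnth p i + H.
Proof.
move=> h0; split=> [sub i|sub x xd i]; last first.
  have [pd dp] := sub i; have /andP[dx xh] := xd i.
  by rewrite (le_trans pd)//= (lt_le_trans xh).
have dd : hbox d h d by move=> l; rewrite lexx ltrDl.
have /andP[pd dp] := sub _ dd i; split => //.
rewrite leNgt; apply/negP => ph.
pose y : n.-tuple R :=
  [tuple if l == i then tnth p i + H else tnth d l | l < n].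
have : hbox d h y.
  move=> l; rewrite tnth_mktuple; case: eqVneq => [->|_]; last exact: dd.
  by rewrite ph ltW.
by move=> /sub/(_ i); rewrite tnth_mktuple eqxx ltxx andbF.
Qed.

(** Interpolate affinely between the two cubes. The cubes [B x] increase with
    [x], so [|E & B x|] increases by no more than [|B x|], which is a polynomial
    in [x]; the intermediate value theorem applies. *)
Lemma hbox_grow (E : set (Rn R n)) (d p : n.-tuple R) (h H t : R) :
  measurable E -> 0 < h <= H -> 0 <= t <= 1 -> hbox d h `<=` hbox p H ->
  (t%:E * mu (hbox d h) <= mu (E `&` hbox d h))%E ->
  (mu (E `&` hbox p H) <= t%:E * mu (hbox p H))%E ->
  exists b s, [/\ h <= s, hbox b s `<=` hbox p H &
    mu (E `&` hbox b s) = (t%:E * mu (hbox b s))%E].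
Proof.
move=> mE /andP[h0 hH] /andP[t0 t1] sub dE pE.
pose b x : n.-tuple R := [tuple (1 - x) * tnth d i + x * tnth p i | i < n].
pose s x := (1 - x) * h + x * H.
pose B x := hbox (b x) (s x).
have hs x : 0 <= x -> h <= s x.
  move=> x0; rewrite /s mulrBl mul1r -addrA lerDl addrC -mulrBr.
  by rewrite mulr_ge0// subr_ge0.
have s0 x : 0 <= x -> 0 < s x by move=> /hs; exact: lt_le_trans.
have Bsub x y : 0 <= x -> x <= y -> B x `<=` B y.
  move=> x0 xy; apply/hbox_subP => [|i]; first exact: s0.
  have [pd dp] := (hbox_subP _ _ _ h0).1 sub i.
  rewrite !tnth_mktuple; split.
    by rewrite -subr_ge0; have : 0 <= (y - x) * (tnth d i - tnth p i);
      [by rewrite mulr_ge0// subr_ge0|lra].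
  by rewrite -subr_ge0 /s;
    have : 0 <= (y - x) * (tnth p i + H - (tnth d i + h));
      [by rewrite mulr_ge0// subr_ge0|lra].
have B0 : B 0 = hbox d h.
  rewrite /B /s subr0 mul1r mul0r addr0; congr hbox; apply: eq_from_tnth => i.
  by rewrite tnth_mktuple subr0 mul1r mul0r addr0.
have B1 : B 1 = hbox p H.
  rewrite /B /s subrr mul1r mul0r add0r; congr hbox; apply: eq_from_tnth => i.
  by rewrite tnth_mktuple subrr mul1r mul0r add0r.
pose g x := s x ^+ n.
pose f x := fine (mu (E `&` B x)).
have muB x : 0 <= x -> mu (B x) = (g x)%:E.
  by move=> x0; rewrite lebesgue_hbox// ltW// s0.
have muEB x : 0 <= x -> mu (E `&` B x) = (f x)%:E.
  by move=> x0; rewrite /f fineK// lebesgue_hboxI_fin// ltW// s0.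
have mB x : measurable (B x) by exact: measurable_hbox.
have fmono x y : 0 <= x -> x <= y -> f x <= f y.
  move=> x0 xy; rewrite -lee_fin -!muEB ?(le_trans x0)//.
  by apply: le_lebesgue; apply: setIS; exact: Bsub.
have fgmono x y : 0 <= x -> x <= y -> f y - f x <= g y - g x.
  move=> x0 xy; have y0 := le_trans x0 xy.
  have gE : (g y)%:E = ((g x)%:E + mu (B y `\` B x))%E.
    rewrite -!muB// -measureU//; first by rewrite setDUK//; exact: Bsub.
      exact: measurableD.
    by rewrite setDIK.
  have fE : ((f y)%:E <= (f x)%:E + mu (B y `\` B x))%E.
    rewrite -!muEB//; apply: le_trans (lebesgueU_le _ _).
    apply: le_lebesgue => z [Ez yz].
    by have [xz|nxz] := pselect (B x z); [left|right].
  have Dfin : mu (B y `\` B x) \is a fin_num.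
    rewrite ge0_fin_numE// (le_lt_trans (le_lebesgue (@subDsetl _ _ _)))//.
    by rewrite muB// ltry.
  move: gE fE; rewrite -(fineK Dfin) -!EFinD lee_fin => -[->] ?.
  by lra.
have gc : continuous g.
  move=> x; apply: (@continuous_comp _ _ _ s (fun z => z ^+ n));
    last exact: exprn_continuous.
  apply: cvgD; apply: cvgM; [|exact: cvg_cst|exact: cvg_id|exact: cvg_cst].
  by apply: cvgB; [exact: cvg_cst|exact: cvg_id].
pose u x := f x - t * g x.
have gmono x y : 0 <= x -> x <= y -> g x <= g y.
  by move=> x0 xy; have := fgmono _ _ x0 xy; have := fmono _ _ x0 xy; lra.
have udist x y : 0 <= x -> x <= y -> `|u x - u y| <= `|g x - g y|.
  move=> x0 xy; have H1 := fgmono _ _ x0 xy; have H2 := fmono _ _ x0 xy.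
  have H3 := gmono _ _ x0 xy.
  rewrite (distrC (g x)) (ger0_norm (_ : 0 <= g y - g x)) ?subr_ge0//.
  have H4 : 0 <= t * (g y - g x) by rewrite mulr_ge0// subr_ge0.
  have H5 : t * (g y - g x) <= g y - g x by rewrite ler_piMl// subr_ge0.
  by rewrite ler_norml /u; apply/andP; split; lra.
have uc : {within `[0, 1], continuous u}.
  apply/subspace_continuousP => x; rewrite /= in_itv/= => /andP[x0 _].
  apply/cvgrPdist_le => e e0.
  have /cvgrPdist_le/(_ e e0) := gc x; apply: filterS => y /= gxy.
  rewrite in_itv/= => /andP[y0 _]; apply: le_trans gxy.
  by have [xy|/ltW yx] := leP x y;
    [|rewrite distrC (distrC (g x))]; exact: udist.
have [|x] := IVT (v := 0) ler01 uc.
  move: dE pE; rewrite -B0 -B1 !muEB// !muB// -!EFinM !lee_fin => u0 u1.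
  by rewrite ge_min le_max /u !subr_ge0 !subr_le0 u0 u1 orbT.
rewrite in_itv/= => /andP[x0 x1] ux.
exists (b x), (s x); split; first exact: hs.
  by rewrite -B1; exact: Bsub.
rewrite -/(B x) muEB// muB// -EFinM; congr EFin.
by apply/eqP; rewrite -subr_eq0; apply/eqP.
Qed.

End grow.

(** * From dense cubes to the maximal function *)

Section tauberian.
Context {R : realType} {n : nat}.
Local Notation mu := (lebesgue R n).

(** The closure of a half-open cube is admissible in the supremum: it has the
    same measure and meets [E] in at least as much. *)
Lemma hbox_sub_maximal (E : set (Rn R n)) (a b : n.-tuple R) (r s l : R) :
  measurable E -> 0 < s -> hbox b s `<=` hbox a r ->
  (l%:E * mu (hbox b s) < mu (E `&` hbox b s))%E ->
  hbox b s `<=` [set x | cube (a : Rn R n) r x /\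
                         (l%:E < cube_maximal (cube (a : Rn R n) r) \1_E x)%E].
Proof.
move=> mE s0 sub; rewrite lebesgue_hbox ?ltW// => El x xb.
split; first exact/hbox_sub_cube/sub.
set S : set (Rn R n) := cube (b : Rn R n) s.
have sn : 0 < s ^+ n by rewrite exprn_gt0.
apply: lt_le_trans (_ : (\int[mu]_(y in S) `|(\1_E y)%:E| / mu S <= _)%E);
  last first.
  apply: ereal_sup_ubound; exists S => //.
  split; [by exists b, s|exact: hbox_sub_cube|].
  move=> y yb i; have /andP[by1 by2] := yb i.
  have [ab ba] := (hbox_subP _ _ _ s0).1 sub i.
  by rewrite (le_trans ab)//= (le_trans by2).
under eq_integral do rewrite gee0_abs ?lee_fin//.
rewrite integral_indic//; last exact: measurable_cube.
rewrite /S lebesgue_cube ?ltW// inver gt_eqF// lte_pdivlMr// -EFinM.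
rewrite EFinM; apply: lt_le_trans El _; apply: le_lebesgue.
by apply: setIS; exact: hbox_sub_cube.
Qed.

End tauberian.

(** * Stopping cubes *)

Section selection.
Context {R : realType} {n : nat}.
Variables (a : n.-tuple R) (r t : R) (E : set (Rn R n)).
Hypothesis r0 : 0 < r.
Local Notation mu := (lebesgue R n).

Definition heavy k j :=
  (t%:E * mu (dcube a r k j) <= mu (E `&` dcube a r k j))%E.

(** The cube itself is light although one of its children is heavy: the density
    [t] is crossed between the two. *)
Definition stopping k j := ~ heavy k j /\
  exists2 j', dcube a r k.+1 j' `<=` dcube a r k j & heavy k.+1 j'.

(** Maximality is expressed through disjointness: by nestedness, a stopping cube
    of an earlier generation either contains the given one or misses it. *)
Definition selected (p : nat * n.-tuple nat) :=
  [/\ stopping p.1 p.2, dcube a r p.1 p.2 `<=` hbox a r &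
    forall k j, (k < p.1)%N -> stopping k j ->
      dcube a r k j `&` dcube a r p.1 p.2 = set0].

Lemma selected_inj p q x : selected p -> selected q ->
  dcube a r p.1 p.2 x -> dcube a r q.1 q.2 x -> p = q.
Proof.
case: p q => [k j] [l m] [/= sk _ kmin] [/= sl _ lmin] xk xl.
case: (ltngtP k l) => [kl|lk|kl].
- by have := lmin _ _ kl sk; rewrite -subset0 => /(_ x) [].
- by have := kmin _ _ lk sl; rewrite -subset0 => /(_ x) [].
- by rewrite -kl in xl *; rewrite (dcube_inj r0 xk xl).
Qed.

(** At the first generation whose cube around [x] is heavy, the parent is light,
    hence stopping; the first stopping cube around [x] is then selected. *)
Lemma selected_cover k j x : ~ heavy 0 zero_index -> hbox a r x ->
  dcube a r k j x -> heavy k j -> exists2 p, selected p & dcube a r p.1 p.2 x.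
Proof.
move=> nd0 xQ xj dj.
have : exists k, `[< exists2 j, dcube a r k j x & stopping k j >].
  have : exists k, `[< exists2 j, dcube a r k j x & heavy k j >].
    by exists k; apply/asboolP; exists j.
  move=> /ex_minnP[] [|m] /asboolP[i xi di] mmin.
    have x0 : dcube a r 0 zero_index x by rewrite dcube0.
    by exfalso; apply: nd0; rewrite (dcube_inj r0 x0 xi).
  have [i' xi'] := dcube_cover r0 m xQ.
  exists m; apply/asboolP; exists i' => //; split.
    move=> di'; have : (m < m)%N by apply: mmin; apply/asboolP; exists i'.
    by rewrite ltnn.
  by exists i => //; exact: (dcube_nested r0 _ xi' xi).
move=> /ex_minnP[m /asboolP[i xi si] mmin]; exists (m, i) => //; split => //=.
  exact: (dcube_sub r0 xQ xi).
move=> l q lm sq; have lm' := ltnW lm; rewrite -subset0 => y [yq yi].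
move: lm; rewrite ltnNge => /negP; apply; apply: mmin.
apply/asboolP; exists q => //.
exact: (dcube_nested r0 lm' yq yi xi).
Qed.

(** The last bound holds because the grown cube contains a child of the selected
    one. *)
Lemma selected_grow p : measurable E -> 0 <= t <= 1 -> selected p -> exists bs,
  [/\ 0 < bs.2, hbox bs.1 bs.2 `<=` dcube a r p.1 p.2,
      mu (E `&` hbox bs.1 bs.2) = (t * bs.2 ^+ n)%:E &
      (r / 2 ^+ p.1) ^+ n <= 2 ^+ n * bs.2 ^+ n].
Proof.
case: p => k j /= mE t01 [[/= ndkj [j' sub dj']] _ _].
have hk m : 0 < r / 2 ^+ m by rewrite divr_gt0// exprn_gt0.
have hE : r / 2 ^+ k = 2 * (r / 2 ^+ k.+1).
  by rewrite exprS invfM mulrCA mulVKf.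
have [||b [s [hs bsub bE]]] := hbox_grow mE _ t01 sub dj'.
- by rewrite hk/= hE ler_peMl ?ler1n// ltW.
- by apply: ltW; rewrite ltNge; apply/negP.
have s0 : 0 < s by exact: lt_le_trans hs.
exists (b, s); split => //=; first by rewrite bE lebesgue_hbox// ltW.
rewrite -exprMn lerXn2r ?nnegrE ?(ltW (hk _)) ?mulr_ge0 ?(ltW s0)//.
by rewrite hE ler_pM2l.
Qed.

Lemma measurable_heavy_bigcup :
  measurable (\bigcup_(p in [set p | heavy p.1 p.2]) dcube a r p.1 p.2).
Proof.
rewrite bigcup_mkcond; apply: countable_bigcupT_measurable.
  exact: countableP.
by move=> p; case: ifP => // _; exact: measurable_dcube.
Qed.

(** The part of [E] outside all heavy cubes misses every heavy cube and has
    density at most [t] in every other one. *)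
Lemma ae_heavy : measurable E -> 0 < t < 1 -> E `<=` hbox a r ->
  mu (E `\` \bigcup_(p in [set p | heavy p.1 p.2]) dcube a r p.1 p.2) = 0%E.
Proof.
move=> mE t01 EQ.
have mU := measurable_heavy_bigcup.
apply: (subdensity_null r0 t01); [exact: measurableD|by move=> x [/EQ xQ _]|].
move=> k j; have [dkj|ndkj] := pselect (heavy k j).
  rewrite (_ : _ `&` _ = set0) ?measure0 ?mule_ge0//.
    by rewrite lee_fin ltW//; case/andP: t01.
  by rewrite -subset0 => x [[_ nx] xj]; apply: nx; exists (k, j).
apply: le_trans (ltW (_ : (mu (E `&` dcube a r k j) < _)%E)).
  by apply: le_lebesgue => x [[]].
by rewrite ltNge; apply/negP.
Qed.

(** [G] stands for the superlevel set of the maximal function. It contains almost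
    all of [E], through the heavy cubes, and the grown cubes of exact density
    [t]; the parts of the latter outside [E] are disjoint and pay for the parts
    of [E] in the selected cubes. *)
Lemma lebesgue_gain (G : set (Rn R n)) : measurable E -> 0 < t < 1 ->
  E `<=` hbox a r -> ~ heavy 0 zero_index ->
  (forall b s, 0 < s -> hbox b s `<=` hbox a r ->
    (t%:E * mu (hbox b s) <= mu (E `&` hbox b s))%E -> hbox b s `<=` G) ->
  (mu E + ((1 - t) / (2 ^+ n * t))%:E * mu E <= mu G)%E.
Proof.
move=> mE t01 EQ nd0 hG; have /andP[t0 t1] := t01.
have t01w : 0 <= t <= 1 by rewrite !ltW.
pose grown (p : nat * n.-tuple nat) (bs : n.-tuple R * R) :=
  [/\ 0 < bs.2, hbox bs.1 bs.2 `<=` dcube a r p.1 p.2,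
      mu (E `&` hbox bs.1 bs.2) = (t * bs.2 ^+ n)%:E &
      (r / 2 ^+ p.1) ^+ n <= 2 ^+ n * bs.2 ^+ n].
have /choice[bs bsP] : forall p, exists bs, selected p -> grown p bs.
  move=> p.
  have [sp|nsp] := pselect (selected p).
    by have [bs ?] := selected_grow mE t01w sp; exists bs.
  by exists (a, r).
pose sel p := `[< selected p >].
(* [F p] is the part of [E] in the selected cube [D p], and [H p] the gain
   that pays for it; [E1] is the part of [E] covered by heavy cubes. *)
pose D p := if sel p then dcube a r p.1 p.2 else set0.
pose F p := E `&` D p.
pose H p := if sel p then hbox (bs p).1 (bs p).2 `\` E else set0.
pose E1 := E `&` \bigcup_(p in [set p | heavy p.1 p.2]) dcube a r p.1 p.2.
have mD p : measurable (D p).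
  by rewrite /D; case: ifP => // _; exact: measurable_dcube.
have mH p : measurable (H p).
  rewrite /H; case: ifP => // _.
  by apply: measurableD => //; exact: measurable_hbox.
have mUH : measurable (\bigcup_p H p).
  by apply: countable_bigcupT_measurable => //; exact: countableP.
have mU := measurable_heavy_bigcup.
have mE1 : measurable E1 by exact: measurableI.
have muE1 : mu E1 = mu E.
  apply/eqP; rewrite eq_le; apply/andP; split.
    exact: le_lebesgue (@subIsetl _ _ _).
  rewrite -[leRHS]adde0 -(ae_heavy mE t01 EQ).
  apply: le_trans (lebesgueU_le _ _).
  by rewrite setUIDK.
have cFH : (((1 - t) / (2 ^+ n * t))%:E * mu (\bigcup_p F p) <=
            mu (\bigcup_p H p))%E.
  apply: (countable_sum_le (D := D)) => //.
  - by rewrite divr_ge0 ?mulr_ge0 ?exprn_ge0 ?subr_ge0// ltW.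
  - move=> p q x; rewrite /D; case: ifPn => // /asboolP sp.
    by case: ifPn => // /asboolP sq; exact: selected_inj.
  - by move=> p; exact: measurableI.
  - by move=> p x [].
  - move=> p x; rewrite /H /D; case: ifPn => // /asboolP /bsP[_ sub _ _] [/sub].
    by [].
  - move=> p; rewrite /F /H /D; case: ifPn => [/asboolP sp|_]; last first.
      by rewrite setI0 measure0 mule0.
    have [s0 sub Es ps] := bsP _ sp.
    have ndp : (mu (E `&` dcube a r p.1 p.2) <=
                t%:E * mu (dcube a r p.1 p.2))%E.
      by case: sp => -[/negP + _] _ _; rewrite -ltNge => /ltW.
    have -> : mu (hbox (bs p).1 (bs p).2 `\` E) = ((1 - t) * (bs p).2 ^+ n)%:E.
      set S := hbox _ _ in Es *.
      have : mu S = (mu (S `\` E) + mu (E `&` S))%E.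
        by rewrite setIC; apply: measureDI => //; exact: measurable_hbox.
      rewrite Es lebesgue_hbox ?ltW//.
      case: (mu (_ `\` _)) => [y|//|//] [sE].
      by rewrite mulrBl mul1r {1}sE addrK.
    apply: le_trans (lee_wpmul2l _ ndp) _.
      by rewrite lee_fin divr_ge0 ?mulr_ge0 ?exprn_ge0 ?subr_ge0// ltW.
    rewrite lebesgue_dcube// -!EFinM lee_fin invfM !mulrA mulfVK ?gt_eqF//.
    rewrite -mulrA ler_wpM2l//; first by rewrite subr_ge0 ltW.
    by rewrite ler_pdivrMl ?exprn_gt0.
have E1F : E1 `<=` \bigcup_p F p.
  move=> x [Ex [[k j] /= dkj xj]].
  have [p sp xp] := selected_cover nd0 (EQ _ Ex) xj dkj.
  by exists p => //; split => //; rewrite /D ifT//; apply/asboolP.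
have subG : E1 `|` \bigcup_p H p `<=` G.
  move=> x [[Ex [[k j] /= dkj xj]]|[p _]].
    apply: (hG _ _ _ _ dkj); last exact: xj.
      by rewrite divr_gt0// exprn_gt0.
    exact: (dcube_sub r0 (EQ _ Ex) xj).
  rewrite /H; case: ifPn => // /asboolP sp [xp _].
  have [s0 sub Es _] := bsP _ sp.
  apply: (hG _ _ s0 _ _ _ xp).
    by case: sp => _ Q _; exact: subset_trans sub Q.
  by rewrite Es EFinM lebesgue_hbox ?(ltW s0).
apply: le_trans (le_lebesgue subG).
have -> : mu (E1 `|` \bigcup_p H p) = (mu E1 + mu (\bigcup_p H p))%E.
  apply: measureU => //; rewrite -subset0 => x [[Ex _] [p _]]; rewrite /H.
  by case: ifP => // _ [].
rewrite muE1; apply: leeD => //; apply: le_trans cFH.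
apply: lee_wpmul2l.
  by rewrite lee_fin divr_ge0 ?mulr_ge0 ?exprn_ge0 ?subr_ge0// ltW.
by rewrite -muE1; exact: le_lebesgue.
Qed.

End selection.

(** * The Tauberian bound *)

Theorem theorem1p1 (R : realType) (n : nat) (hn : (1 <= n)%N) :
  exists B : R, 0 < B /\
    forall Q : set (Rn R n), is_cube Q ->
    forall lambda : R, 0 < lambda < 1 ->
      ((1 + (1 - lambda) / (B * lambda))%:E <= tauberian_const Q lambda)%E.
Proof.
exists (2 ^+ n.+1); split; first by rewrite exprn_gt0.
move=> _ [a [r [r0 ->]]] l /andP[l0 l1].
apply: le_ereal_inf_tmp => _ [E [mE EQ E0 El] <-].
pose Q0 := hbox (a : n.-tuple R) r.
have mQ0 : measurable Q0 by exact: measurable_hbox.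
have muQ : lebesgue R n (cube a r) = (r ^+ n)%:E by rewrite lebesgue_cube// ltW.
have muE : lebesgue R n (E `&` Q0) = lebesgue R n E.
  apply/eqP; rewrite eq_le; apply/andP; split.
    exact: le_lebesgue (@subIsetl _ _ _).
  rewrite -[leRHS]adde0 -(lebesgue_cube_boundary a (ltW r0)).
  apply: le_trans (lebesgueU_le _ _).
  apply: le_lebesgue => x Ex; have [xQ|nxQ] := pselect (Q0 x); first by left.
  by right; split => //; exact: EQ.
have Efin : lebesgue R n E \is a fin_num.
  rewrite ge0_fin_numE//; apply: le_lt_trans (le_lebesgue EQ) _.
  by rewrite muQ ltry.
have p1 : 0 < 1 + l by rewrite addr_gt0.
(* Chosen so that [(1 - t) / t] is half of [(1 - l) / l]. *)
pose t := 2 * l / (1 + l).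
have lt : l < t by rewrite /t ltr_pdivlMr//; nra.
have t1 : t < 1 by rewrite /t ltr_pdivrMr//; nra.
have t0 : 0 < t := lt_trans l0 lt.
have rn : 0 < r ^+ n by rewrite exprn_gt0.
have := @lebesgue_gain R n a r t (E `&` Q0) r0
  [set x | cube a r x /\ (l%:E < cube_maximal (cube a r) \1_E x)%E].
rewrite muE => /(_ (measurableI _ _ mE mQ0)).
rewrite t0 t1 => /(_ isT (@subIsetr _ _ _)).
have -> : (1 - t) / (2 ^+ n * t) = (1 - l) / (2 ^+ n.+1 * l).
  rewrite /t exprS; field.
  by rewrite !gt_eqF//= ?exprn_gt0//; lra.
move=> gain.
move: E0 gain; rewrite -(fineK Efin) lte_fin => e0.
rewrite inver gt_eqF// lee_pdivlMr// -EFinM -EFinD.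
rewrite -[X in (X + _)%:E]mul1r -mulrDl.
rewrite EFinM; apply.
  apply/negP; rewrite -ltNge dcube0 -setIA setIid muE lebesgue_hbox ?ltW//.
  apply: le_lt_trans El _.
  by rewrite muQ -!EFinM lte_fin ltr_pM2r.
move=> b s s0 sub tE; apply: hbox_sub_maximal => //.
apply: lt_le_trans (_ : t%:E * lebesgue R n (hbox b s) <= _)%E.
  by rewrite lebesgue_hbox ?ltW// -!EFinM lte_fin ltr_pM2r// exprn_gt0.
apply: le_trans tE _.
by apply: le_lebesgue => x [[]].
Qed.
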